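(* For any sequence length $N$, input range $M=N^{O(1)}$, and fixed-precision bit complexity $p=O(\log M)$, there exists a third-order transformer $f\in\mathcal{T}^{1,1,\otimes3}_{1,m,1,p}$ with a single (third-order) self-attention unit with embedding dimension $m=5$ such that $f(X)=\mathrm{Match3}(X)$ for all $X\in[M]^N$ (where $f$ may use a positional encoding and a single appended blank token, as specified in the context).
   Context: $[M]=\{1,\dots,M\}$. For $X=(x_1,\dots,x_N)\in[M]^N$, $\mathrm{Match3}(X)\in\{0,1\}^N$ is defined by $\mathrm{Match3}(X)_i=1$ if there exist $j_1,j_2\in[N]$ with $x_i+x_{j_1}+x_{j_2}\equiv0\pmod M$, and $0$ otherwise. Tensor notation. For $v^1\in\mathbb{R}^{N_1}$, $v^2\in\mathbb{R}^{N_2}$, the Kronecker product $v^1\otimes v^2\in\mathbb{R}^{N_1N_2}$ is $(v^1\otimes v^2)_{(i_1-1)N_2+i_2}=v^1_{i_1}v^2_{i_2}$. The column-wise Kronecker product of $A^1\in\mathbb{R}^{N_1\times m}$ and $A^2\in\mathbb{R}^{N_2\times m}$ with columns $A^1_k,A^2_k$ is $A^1\star A^2=[A^1_1\otimes A^2_1\mid\cdots\mid A^1_m\otimes A^2_m]\in\mathbb{R}^{N_1N_2\times m}$. $s$-order self-attention. For $s\ge2$ and matrices $Q,K^1,\dots,K^{s-1}\in\mathbb{R}^{d\times m}$, $V^1,\dots,V^{s-1}\in\mathbb{R}^{d\times d'}$ encoded with $p$-bit fixed-point numbers, an $s$-order self-attention unit is $f_{Q,K,V}:\mathbb{R}^{N\times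 d}\to\mathbb{R}^{N\times d'}$, $$f_{Q,K,V}(X)=\mathrm{softmax}\big(XQ\,((XK^1)\star\cdots\star(XK^{s-1}))^{\mathsf T}\big)\,\big((XV^1)\star\cdots\star(XV^{s-1})\big),$$ where softmax is row-wise, $\mathrm{softmax}(A)_{i,j}=\exp(A_{i,j})/\sum_{j'}\exp(A_{i,j'})$, applied to an $N\times N^{s-1}$ matrix. $\mathcal{A}^{\otimes s}_{d,m,d',p}$ is the set of all such units. MLP layer. $\Phi_{d,d',p}$ is the set of all (arbitrary) functions $\phi:\mathbb{R}^d\to\mathbb{R}^{d'}$ whose real-valued inputs and outputs can be represented using $p$-bit fixed-precision numbers, applied row-wise. Single-layer single-headed $s$-order transformers: $\mathcal{T}^{1,1,\otimes s}_{d,m,d',p}=\Phi_{m,d',p}\,\mathcal{A}^{\otimes s}_{m,m,m,p}\,\Phi_{d,m,p}$ (composition: input MLP, attention unit, output MLP). Conventions. Positional encoding: the index $i$ of an element may be encoded as an extra coordinate of the input, so the input MLP may depend on $i$ as well as on $x_i$. Blank token: the model may append a single constant token $x'$ to the sequence; $f$ represents a target $h$ on length-$N$ sequences if $f(X')_{1:N}=h(X)$ for $X'=(x_1,\dots,x_N,x')$.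
   Formalization: The formal theorem adds the assumption that N is at most 2^(M^b) for an arbitrary constant b, since for a large constant M and N growing, p=O(log M) bits cannot suffice; the precision bound is stated as p = O(log(M+1)). *)

(* Defs.v *)
From HB Require Import structures.
From mathcomp Require Import all_boot all_order all_algebra.
From mathcomp Require Import all_classical all_reals all_analysis.
From mathcomp Require Import mxtens.

Set Implicit Arguments.
Unset Strict Implicit.
Unset Printing Implicit Defensive.

Import Order.TTheory GRing.Theory Num.Theory.

Local Open Scope classical_set_scope.
Local Open Scope ring_scope.

Definition Match3 (M N : nat) (X : 'I_N -> nat) (i : 'I_N) : bool :=
  [exists j1 : 'I_N, exists j2 : 'I_N,
    (X i + X j1 + X j2 == 0 %[mod M])%N].

Section Transformers.
Context {R : realType}.

(* A p-bit fixed-point number is k / 2 ^ (p %/ 2) for a p-bit two's-complement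
   integer k, - 2 ^ (p - 1) <= k < 2 ^ (p - 1) (p >= 1): the binary point is in
   the middle of the word. *)
Definition fixed_point (p : nat) : set R :=
  [set x | exists2 k : int,
     - 2 ^+ p.-1 <= k < 2 ^+ p.-1 & x = k%:~R / 2 ^+ p./2].

(* Rounding to the nearest p-bit number, ties upwards, saturating outside the
   representable range. *)
Definition fixed_round (p : nat) (x : R) : R :=
  (Num.max (- 2 ^+ p.-1 : int)
     (Num.min (2 ^+ p.-1 - 1) (Num.floor (x * 2 ^+ p./2 + 2^-1))))%:~R
  / 2 ^+ p./2.

Definition fixed_point_mx (p : nat) {m n : nat} (A : 'M[R]_(m, n)) : Prop :=
  forall i j, fixed_point p (A i j).

(* mxtens_index (i, j) is the 0-based index i * N2 + j, so that tensmx ( *t )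
   on column vectors is the Kronecker product v1 (x) v2. *)
Definition colkron {N1 N2 m : nat} (A1 : 'M[R]_(N1, m)) (A2 : 'M[R]_(N2, m)) :
    'M[R]_(N1 * N2, m) :=
  \matrix_(i, k) (tensmx (col k A1) (col k A2)) i ord0.

(* The column-wise product of A 0, ..., A n, bracketed to the right; the types
   match because N ^ n.+2 is convertible to N * N ^ n.+1. *)
Fixpoint colkrons {N m : nat} (n : nat) :
    ('I_n.+1 -> 'M[R]_(N, m)) -> 'M[R]_((N ^ n.+1)%N, m) :=
  match n return ('I_n.+1 -> 'M[R]_(N, m)) -> 'M[R]_((N ^ n.+1)%N, m) with
  | 0 => fun A => A ord0
  | n'.+1 => fun A => colkron (A ord0) (colkrons (fun i => A (lift ord0 i)))
  end.

Definition softmax {m n : nat} (A : 'M[R]_(m, n)) : 'M[R]_(m, n) :=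
  \matrix_(i, j) (expR (A i j) / \sum_(j' < n) expR (A i j')).

(* For s >= 2 the index type 'I_(s.-2).+1 has s - 1 elements. *)
Definition attention (N s d m d' : nat) (Q : 'M[R]_(d, m))
    (K : 'I_(s.-2).+1 -> 'M[R]_(d, m)) (V : 'I_(s.-2).+1 -> 'M[R]_(d, d'))
    (X : 'M[R]_(N, d)) : 'M[R]_(N, d') :=
  softmax (X *m Q *m (colkrons (fun t => X *m K t))^T)
    *m colkrons (fun t => X *m V t).

Definition attention_class (N s d m d' p : nat) :
    set ('M[R]_(N, d) -> 'M[R]_(N, d')) :=
  [set f | exists (Q : 'M[R]_(d, m)) (K : 'I_(s.-2).+1 -> 'M[R]_(d, m))
      (V : 'I_(s.-2).+1 -> 'M[R]_(d, d')),
    [/\ fixed_point_mx p Q, forall t, fixed_point_mx p (K t),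
        forall t, fixed_point_mx p (V t)
      & forall X, f X = attention Q K V X]].

(* An arbitrary function of the p-bit roundings of its inputs, with p-bit
   outputs. *)
Definition mlp_class (d d' p : nat) : set ('rV[R]_d -> 'rV[R]_d') :=
  [set phi | (forall x, phi x = phi (map_mx (fixed_round p) x)) /\
             (forall x, fixed_point_mx p (phi x))].

Definition rowwise {N d d' : nat} (phi : 'rV[R]_d -> 'rV[R]_d')
    (X : 'M[R]_(N, d)) : 'M[R]_(N, d') :=
  \matrix_(i < N) phi (row i X).

(* Single-layer single-headed s-order transformers on sequences of length N. *)
Definition transformer_class (N s d m d' p : nat) :
    set ('M[R]_(N, d) -> 'M[R]_(N, d')) :=
  [set f | exists (phi_in : 'rV[R]_d -> 'rV[R]_m)
      (att : 'M[R]_(N, m) -> 'M[R]_(N, m)) (phi_out : 'rV[R]_m -> 'rV[R]_d'),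
    [/\ mlp_class p phi_in, attention_class s m p att, mlp_class p phi_out
      & forall X, f X = rowwise phi_out (att (rowwise phi_in X))]].

(* Positional encoding: the 1-based index of each row is appended to it as an
   extra coordinate. *)
Definition with_position {N d : nat} (X : 'M[R]_(N, d)) : 'M[R]_(N, d + 1) :=
  row_mx X (\col_(i < N) (i.+1)%:R).

(* The column (x_1, ..., x_N, x') with blank token x'. *)
Definition with_blank {N : nat} (X : 'I_N -> nat) (x' : R) : 'cV[R]_(N + 1) :=
  col_mx (\col_(i < N) (X i)%:R) (const_mx x').

(* f represents h on [M]^N: its first N outputs are h(X), whatever it outputs
   on the blank token. *)
Definition represents (M N : nat) (x' : R)
    (f : 'M[R]_(N + 1, 1 + 1) -> 'M[R]_(N + 1, 1))
    (h : ('I_N -> nat) -> 'I_N -> bool) : Prop :=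
  forall X : 'I_N -> nat, (forall i, (1 <= X i <= M)%N) ->
    usubmx (f (with_position (with_blank X x'))) = \col_(i < N) (h X i)%:R.

End Transformers.

Arguments attention_class {R} N s d m d' p _.
Arguments mlp_class {R} d d' p _.
Arguments transformer_class {R} N s d m d' p _.

(* Main.v *)
(* Idea. Map a token x to (cos t, sin t, 1, 0, 0) with t = 2 pi x / M, rounded
   to p bits, and the blank token, encoded as x' = 0, to (0, 0, 0, 1, 0). Four
   of the five attention coordinates realize the trilinear form
   cos (t1 + t2 + t3), scaled by c; the fifth gives the pair (blank, blank) the
   score w. Pairs with exactly one blank score 0. If x1 + x2 + x3 is not a
   multiple of M, the cosine is at most 1 - 2 / M ^ 2, so w can be placed in the
   gap below c with a margin that beats the logarithm of the number of pairs.
   The values are the indicators of nonblank tokens, so the output is the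
   softmax mass of the nonblank pairs: at least 1/2 if there is a match, at most
   1/4 otherwise. *)
Require Import Defs.
From mathcomp Require Import all_boot all_order all_algebra.
From mathcomp Require Import all_classical all_reals all_analysis.
From mathcomp Require Import mxtens ring lra zify.

Set Implicit Arguments.
Unset Strict Implicit.
Unset Printing Implicit Defensive.

Import Order.TTheory GRing.Theory Num.Theory.

Local Open Scope ring_scope.

(** * Rounding error for words of [h.*2] bits, [h] of them fractional *)

Section FixedPoint.
Context {R : realType}.
Implicit Types (p : nat) (x y : R) (k : int).

Lemma fixed_round_in p x : fixed_point p (fixed_round p x).
Proof.
have pow_ge1 : (1 : int) <= 2 ^+ p.-1 by rewrite exprn_ege1.
by rewrite /fixed_round; set k := (k in k%:~R / _); exists k => //; lia.
Qed.

Lemma fixed_round_id p x : fixed_point p x -> fixed_round p x = x.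
Proof.
move=> [k /andP[lek kge] ->]; rewrite /fixed_round.
rewrite mulfVK ?expf_neq0 ?pnatr_eq0//.
have -> : Num.floor (k%:~R + 2^-1 : R) = k.
  by apply: floor_def; rewrite intrD; lra.
by rewrite min_r ?max_r //; lia.
Qed.

Lemma fixed_round_idem p x :
  fixed_round p (fixed_round p x) = fixed_round p x.
Proof. exact/fixed_round_id/fixed_round_in. Qed.

Lemma le_fixed_round p x y : x <= y -> fixed_round p x <= fixed_round p y.
Proof.
move=> xy; rewrite /fixed_round ler_wpM2r ?invr_ge0 ?exprn_ge0 ?ler_int//.
have : Num.floor (x * 2 ^+ p./2 + 2^-1) <= Num.floor (y * 2 ^+ p./2 + 2^-1).
  by rewrite le_floor ?lerD2r ?ler_wpM2r ?exprn_ge0.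
lia.
Qed.

Lemma fixed_point_fraction h k : (0 < h)%N ->
  (`|k| < 2 ^+ h.*2.-1)%R -> fixed_point h.*2 (k%:~R / 2 ^+ h : R).
Proof. by move=> h_gt0 kh; exists k; rewrite ?doubleK//; lia. Qed.

Lemma fixed_point_int h k : (0 < h)%N ->
  (`|k| < 2 ^+ h.-1)%R -> fixed_point h.*2 (k%:~R : R).
Proof.
move=> h_gt0 kh.
have -> : k%:~R = (k * 2 ^+ h)%:~R / 2 ^+ h :> R.
  by rewrite intrM rmorphXn /= mulfK ?expf_neq0 ?pnatr_eq0.
apply: fixed_point_fraction => //.
have -> : h.*2.-1 = (h.-1 + h)%N by lia.
by rewrite normrM exprD [`|2 ^+ h|]ger0_norm ?exprn_ge0// ltr_pM2r ?exprn_gt0.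
Qed.

Lemma fixed_round_norm_le1 h x : (1 < h)%N -> `|x| <= 1 ->
  `|fixed_round h.*2 x| <= 1.
Proof.
move=> h_gt1; rewrite !ler_norml => /andP[x1 x2].
have fix1 (k : int) : `|k| <= 1 -> fixed_round h.*2 (k%:~R : R) = k%:~R.
  move=> k1; apply/fixed_round_id/fixed_point_int; first by lia.
  by rewrite (le_lt_trans k1)// exprn_egt1//; lia.
have := le_fixed_round h.*2 x1; have := le_fixed_round h.*2 x2.
by rewrite (fix1 1)// (fix1 (- 1))// => -> ->.
Qed.

(** Rounding is monotone and fixes the two consecutive multiples of 2^-h around [x], so it stays
    between them. The bound [2 < h] keeps both in range, even for |x| = 1, so nothing saturates. *)
Lemma fixed_round_close h x : (2 < h)%N -> `|x| <= 1 ->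
  `|fixed_round h.*2 x - x| <= 2 ^- h.
Proof.
move=> h_gt2 x1; pose k := Num.floor (x * 2 ^+ h).
have P : 0 < 2 ^+ h :> R by rewrite exprn_gt0.
have /andP[lo hi] := floor_itv (x * 2 ^+ h); rewrite -/k in lo hi.
have kb : `|k| <= 2 ^+ h :> int.
  have : `|x * 2 ^+ h| <= 2 ^+ h.
    by rewrite normrM (ger0_norm (ltW P)) ler_piMl// ltW.
  rewrite !ler_norml => /andP[l r].
  rewrite floor_ge_int rmorphN rmorphXn /= l -(ler_int R) rmorphXn /=.
  exact: le_trans r.
have [lt1 lt2] : `|k| < 2 ^+ h.*2.-1 /\ `|k + 1| < 2 ^+ h.*2.-1.
  have -> : h.*2.-1 = (h.-2 + h.+1)%N by lia.
  rewrite exprD.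
  have : (2 : int) <= 2 ^+ h.-2 by rewrite -[leLHS]expr1 ler_eXn2l//; lia.
  have := exprS (2 : int) h.
  have : (1 : int) <= 2 ^+ h by rewrite exprn_ege1.
  nia.
have h0 : (0 < h)%N by lia.
have lo' : k%:~R / 2 ^+ h <= x by rewrite ler_pdivrMr.
have hi' : x <= (k + 1)%:~R / 2 ^+ h by rewrite ler_pdivlMr// ltW.
have := le_fixed_round h.*2 lo'; have := le_fixed_round h.*2 hi'.
rewrite (fixed_round_id (fixed_point_fraction h0 lt1)).
rewrite (fixed_round_id (fixed_point_fraction h0 lt2)).
by move: lo' hi'; rewrite intrD mulrDl mul1r ler_norml => *; lra.
Qed.

End FixedPoint.

(** * The gap between 1 and the cosine at nonmultiples of [M] *)

Section Trigonometry.
Context {R : realType}.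
Implicit Types (x y z : R) (n k M : nat).

Lemma sin_natmul_le n x : `|sin (n%:R * x)| <= n%:R * `|sin x|.
Proof.
elim: n => [|n IHn]; first by rewrite !mul0r sin0 normr0.
rewrite -natr1 mulrDl mul1r sinD (le_trans (ler_normD _ _))// mulrDl mul1r.
rewrite !normrM lerD// ?(le_trans _ IHn)// ?ler_piMr ?cos_max//.
by rewrite ler_piMl ?cos_max.
Qed.

Lemma sin_pi_fraction_ge M k : (0 < k < M)%N ->
  M%:R^-1 <= sin (k%:R * (pi / M%:R)) :> R.
Proof.
move=> /andP[k0 kM].
have M0 : 0 < M%:R :> R by rewrite ltr0n; lia.
have pi0 := pi_gt0 R.
set t := pi / M%:R : R.
have t0 : 0 < t by rewrite divr_gt0.
have Mt : M%:R * t = pi by rewrite /t; field; rewrite gt_eqF.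
have half : M%:R^-1 <= sin (t / 2).
  (* |sin (n x)| <= n |sin x| for n = M and x = pi / (2 M) gives
     1 <= M sin (pi / (2 M)). *)
  have := sin_natmul_le M (t / 2); rewrite mulrA Mt sin_pihalf normr1.
  have tpi : t <= pi by rewrite -Mt ler_peMl ?(ltW t0)// ler1n; lia.
  rewrite ger0_norm; last by rewrite sin_ge0_pi//; lra.
  by rewrite -ler_pdivrMl// mulr1.
have kt : t <= k%:R * t by rewrite ler_peMl ?(ltW t0)// ler1n.
have kt' : k%:R * t <= pi - t.
  by rewrite -Mt -[X in _ - X]mul1r -mulrBl ler_pM2r// lerBrDr natr1 ler_nat.
have sin_le : {in `[- (pi / 2), pi / 2] &, {mono (@sin R) : x y / x <= y}}.
  by apply: le_mono_in => x y xI yI; rewrite ltr_sin.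
apply: (le_trans half).
case: (lerP (k%:R * t) (pi / 2)) => [kp|kp].
  by rewrite sin_le// ?in_itv /=; lra.
(* Past pi / 2, reflect: sin (k t) = sin (pi - k t), and pi - k t >= t. *)
rewrite -[leRHS]opprK -sinN -(sinDpi) sin_le ?in_itv /=; lra.
Qed.

(** Periodicity reduces [k] modulo [M]; then cos (2 x) = 1 - 2 sin^2 x turns the lower bound on the
    sine at multiples of pi / M into the gap. *)
Lemma cos_fraction_le M k : (0 < M)%N -> ~~ (M %| k)%N ->
  cos (k%:R * (pi *+ 2 / M%:R)) <= 1 - 2 * (M%:R^-1) ^+ 2 :> R.
Proof.
move=> M0 Mk; rewrite [in cos _](divn_eq k M).
have r0 : (0 < k %% M < M)%N by rewrite ltn_mod M0 lt0n andbT.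
have M0' : M%:R != 0 :> R by rewrite pnatr_eq0 -lt0n.
have -> : (k %/ M * M + k %% M)%:R * (pi *+ 2 / M%:R) =
    ((k %% M)%:R * (pi / M%:R)) *+ 2 + pi *+ 2 *+ (k %/ M) :> R.
  by rewrite natrD natrM -[_ *+ (_ %/ _)]mulr_natr; field.
rewrite (periodicn (@cosD2pi R)) cos_mulr2n cos2sin2.
have := sin_pi_fraction_ge r0.
have : 0 < M%:R^-1 :> R by rewrite invr_gt0 ltr0n.
nra.
Qed.

Lemma cos_fraction_eq1 M k : (0 < M)%N -> (M %| k)%N ->
  cos (k%:R * (pi *+ 2 / M%:R)) = 1 :> R.
Proof.
move=> M0 /dvdnP[q ->].
have M0' : M%:R != 0 :> R by rewrite pnatr_eq0 -lt0n.
have -> : (q * M)%:R * (pi *+ 2 / M%:R) = 0 + pi *+ 2 *+ q :> R.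
  by rewrite natrM -[_ *+ q]mulr_natr; field.
by rewrite (periodicn (@cosD2pi R)) cos0.
Qed.

Lemma cos3D x y z : cos (x + y + z) =
  cos x * cos y * cos z - cos x * sin y * sin z
  - sin x * sin y * cos z - sin x * cos y * sin z.
Proof. by rewrite cosD cosD sinD; ring. Qed.

End Trigonometry.

(** Exchange one factor at a time: each exchange costs at most [e], the other two factors being
    bounded by 1. *)
Lemma mul3_close {R : realFieldType} (e a b c a' b' c' : R) :
  `|a| <= 1 -> `|b'| <= 1 -> `|b| <= 1 -> `|c'| <= 1 ->
  `|a' - a| <= e -> `|b' - b| <= e -> `|c' - c| <= e ->
  `|a' * b' * c' - a * b * c| <= 3 * e.
Proof.
move=> a1 b1' b1 c1' da db dc.
have -> : a' * b' * c' - a * b * c =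
  (a' - a) * (b' * c') + (b' - b) * (a * c') + (c' - c) * (a * b) by ring.
have bound (u v w : R) : `|u| <= e -> `|v| <= 1 -> `|w| <= 1 ->
    `|u * (v * w)| <= e.
  move=> ue v1 w1; rewrite !normrM (le_trans _ ue)//.
  by rewrite ler_piMr// mulr_ile1.
rewrite (le_trans (ler_normD _ _))//.
have := ler_normD ((a' - a) * (b' * c')) ((b' - b) * (a * c')).
have := bound _ _ _ da b1' c1'; have := bound _ _ _ db a1 c1'.
have := bound _ _ _ dc a1 b1; lra.
Qed.

(** * Third-order attention as a ratio of double sums over pairs of keys *)

Section Attention3.
Context {R : realType}.
Implicit Types (N d m : nat).

Lemma sum_mxtens_index m n (F : 'I_(m * n) -> R) :
  \sum_k F k = \sum_i \sum_j F (mxtens_index (i, j)).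
Proof.
rewrite pair_big /= (reindex (@mxtens_index m n)) /=.
  by apply: eq_bigr => -[i j].
exists (@mxtens_unindex m n) => k _; first exact: mxtens_indexK.
exact: mxtens_unindexK.
Qed.

Lemma colkronE N1 N2 m (A : 'M[R]_(N1, m)) (B : 'M[R]_(N2, m)) i j k :
  colkron A B (mxtens_index (i, j)) k = A i k * B j k.
Proof. by rewrite !mxE mxtens_indexK. Qed.

Lemma attention3E N d m d' (Q : 'M[R]_(d, m)) (K : 'I_2 -> 'M[R]_(d, m))
    (V : 'I_2 -> 'M[R]_(d, d')) (X : 'M[R]_(N, d)) i k :
  let score j1 j2 := \sum_l (X *m Q) i l *
    ((X *m K ord0) j1 l * (X *m K ord_max) j2 l) in
  attention (s := 3) Q K V X i k =
  (\sum_j1 \sum_j2 expR (score j1 j2) *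
     ((X *m V ord0) j1 k * (X *m V ord_max) j2 k))
  / \sum_j1 \sum_j2 expR (score j1 j2).
Proof.
move=> score; rewrite /attention /=.
have -> : lift ord0 ord0 = ord_max :> 'I_2 by apply: val_inj.
set A := colkron _ _; set B := colkron _ _.
pose E (j : 'I_(N * N)) := expR ((X *m Q *m A^T) i j).
have EE j1 j2 : E (mxtens_index (j1, j2)) = expR (score j1 j2).
  rewrite /E mxE; congr expR; apply: eq_bigr => l _; congr (_ * _).
  by rewrite mxE; exact: colkronE.
transitivity ((\sum_j E j * B j k) / \sum_j E j).
  by rewrite mxE mulr_suml; apply: eq_bigr => j _; rewrite mxE mulrAC.
rewrite !sum_mxtens_index; congr (_ / _).
  apply: eq_bigr => j1 _; apply: eq_bigr => j2 _; rewrite EE; congr (_ * _).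
  exact: colkronE.
by apply: eq_bigr => j1 _; apply: eq_bigr => j2 _; rewrite EE.
Qed.

End Attention3.

(** * Softmax mass on either side of a score margin [D] *)

Section Margin.
Context {R : realType}.

(* The softmax mass of the pairs of nonblank tokens, whose scores are S: the
   2 N pairs with one blank have score 0 and the pair (blank, blank) has
   score w. *)
Definition pair_mass N (S : 'I_N -> 'I_N -> R) (w : R) : R :=
  (\sum_j1 \sum_j2 expR (S j1 j2)) /
  (\sum_j1 \sum_j2 expR (S j1 j2) + 2 * N%:R + expR w).

(** One match suffices: its exponential is at least 8 (N + 1)^2 e^w, which exceeds 2 N + e^w because
    e^w >= 1. *)
Lemma pair_mass_ge N (S : 'I_N -> 'I_N -> R) (w D : R) j1 j2 :
  8 * N.+1%:R ^+ 2 <= expR D -> 0 <= w -> w + D <= S j1 j2 ->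
  2^-1 <= pair_mass S w.
Proof.
move=> largeD w0 SD; rewrite /pair_mass; set T := \sum_j1 _.
have T_ge : expR w * expR D <= T.
  rewrite -expRD (le_trans _ (_ : expR (S j1 j2) <= T)) ?ler_expR//.
  have nneg k1 k2 : 0 <= expR (S k1 k2) by exact: expR_ge0.
  rewrite /T (bigD1 j1)//= (bigD1 j2)//= -addrA lerDl addr_ge0 ?sumr_ge0//.
  by move=> k _; rewrite sumr_ge0.
have w1 : 1 <= expR w by rewrite -expR0 ler_expR.
have N0 : 0 <= N%:R :> R by [].
move: largeD; rewrite -[N.+1%:R]natr1 => lD.
rewrite ler_pdivlMr; nra.
Qed.

(** All N^2 pairs together weigh at most N^2 e^(w - D) <= e^w / 8, so the pair (blank, blank) alone
    keeps the ratio small. *)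
Lemma pair_mass_le N (S : 'I_N -> 'I_N -> R) (w D : R) :
  8 * N.+1%:R ^+ 2 <= expR D -> (forall j1 j2, S j1 j2 <= w - D) ->
  pair_mass S w <= 4^-1.
Proof.
move=> largeD SD; rewrite /pair_mass; set T := \sum_j1 _.
have T_le : T * expR D <= N%:R ^+ 2 * expR w.
  have -> : expR w = expR (w - D) * expR D by rewrite -expRD subrK.
  rewrite mulrA ler_wpM2r ?expR_ge0//.
  have -> : N%:R ^+ 2 * expR (w - D) = \sum_(j1 < N) \sum_(j2 < N) expR (w - D).
    by rewrite !sumr_const !card_ord -mulrnA -[RHS]mulr_natl natrM.
  by apply: ler_sum => j1 _; apply: ler_sum => j2 _; rewrite ler_expR.
have T0 : 0 <= T.
  by rewrite sumr_ge0// => k _; rewrite sumr_ge0// => *; exact: expR_ge0.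
have w0 : 0 < expR w by exact: expR_gt0.
have N0 : 0 <= N%:R :> R by [].
move: largeD; rewrite -[N.+1%:R]natr1 => lD.
have T_le' : T * (8 * (N%:R + 1) ^+ 2) <= N%:R ^+ 2 * expR w.
  by rewrite (le_trans _ T_le)// ler_wpM2l.
have : 8 * T <= expR w.
  have P : 0 < (N%:R + 1) ^+ 2 :> R by rewrite exprn_gt0// ltr_wpDl.
  have T_le'' : (N%:R + 1) ^+ 2 * (8 * T) <= N%:R ^+ 2 * expR w.
    by rewrite [leLHS]mulrC [8 * T]mulrC -mulrA.
  rewrite -(ler_pM2l P) (le_trans T_le'')// ler_wpM2r// ?ltW//; lra.
rewrite ler_pdivrMr; nra.
Qed.
End Margin.

Lemma expR_nat_ge {R : realType} (n : nat) : 2 ^+ n <= expR (n%:R : R).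
Proof.
rewrite -[n%:R]mulr1 expRM_natl lerXn2r// ?nnegrE ?expR_ge0//.
exact: expR_ge1Dx.
Qed.

(** This makes a margin of 2^(b l + 3), polynomial in [M] when 2^l is of order M, sufficient. Since
    N + 1 <= 2^(M^b + 1), the left side is at most 2^(2 M^b + 5), and 2 M^b + 5 <= 8 * 2^(b l). *)
Lemma softmax_margin (N M b l : nat) : (0 < M)%N -> (M <= 2 ^ l)%N ->
  (N <= 2 ^ (M ^ b))%N -> (8 * N.+1 ^ 2 <= 2 ^ (2 ^ (b * l + 3)))%N.
Proof.
move=> M0 Ml Nb.
have Mb : (M ^ b <= 2 ^ (b * l))%N.
  by rewrite mulnC expnM; case: b Nb => // b _; rewrite leq_exp2r.
have Mb0 : (0 < M ^ b)%N by rewrite expn_gt0 M0.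
have N1 : (N.+1 <= 2 ^ (M ^ b).+1)%N.
  by rewrite expnS mul2n -addnn -addn1 leq_add// expn_gt0.
apply: (@leq_trans (2 ^ (3 + (M ^ b).+1 * 2))).
  by rewrite expnD expnM leq_mul// leq_exp2r.
by rewrite leq_exp2l// expnD; lia.
Qed.

(** * The weights and the scores they produce *)

Section Construction.
Context {R : realType}.
Variables (h M : nat) (c w : R).
Implicit Types (v : R) (s : seq R).

(** Missing rows and missing entries are zero by the defaults of [nth], so the lists below stop
    early. *)
Definition mx5 (rows : seq (seq R)) : 'M[R]_5 :=
  \matrix_(i, j) (nth [::] rows i)`_j.

(** Tokens lie in 1..M, so the value 0 identifies the blank. *)
Definition features v : seq R :=
  if v == 0 then [:: 0; 0; 0; 1]
  else [:: fixed_round h.*2 (cos (v * (pi *+ 2 / M%:R)));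
           fixed_round h.*2 (sin (v * (pi *+ 2 / M%:R))); 1; 0].

(* With a, b, d the features of the query and of the two keys, the five
   coordinates of query * (key1 * key2) are, in this order, c a0 b0 d0,
   - c a0 b1 d1, - c a1 b1 d0, - c a1 b0 d1 and w a2 b3 d3. *)
Definition query := mx5
  [:: [:: c; - c; 0; 0; 0]; [:: 0; 0; - c; - c; 0]; [:: 0; 0; 0; 0; w]].

Definition key (t : 'I_2) := if t == ord0
  then mx5 [:: [:: 1; 0; 0; 1]; [:: 0; 1; 1; 0]; [::]; [:: 0; 0; 0; 0; 1]]
  else mx5 [:: [:: 1; 0; 1]; [:: 0; 1; 0; 1]; [::]; [:: 0; 0; 0; 0; 1]].

Definition value (t : 'I_2) := mx5 [:: [::]; [::]; [:: 1]].

(** The addition formula for the cosine of three angles, with entry 0 as cosine and entry 1 as sine;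
    on rounded features it is only approximate, and it vanishes as soon as one argument is the
    blank. *)
Definition cos3 (s1 s2 s3 : seq R) : R :=
  s1`_0 * s2`_0 * s3`_0 - s1`_0 * s2`_1 * s3`_1
  - s1`_1 * s2`_1 * s3`_0 - s1`_1 * s2`_0 * s3`_1.

Lemma scoreE n (f : 'I_n -> seq R) i j1 j2 :
  let X := \matrix_(i < n, j < 5) (f i)`_j in
  \sum_l (X *m query) i l *
    ((X *m key ord0) j1 l * (X *m key ord_max) j2 l) =
  c * cos3 (f i) (f j1) (f j2) + w * ((f i)`_2 * (f j1)`_3 * (f j2)`_3).
Proof.
rewrite /key /= !big_ord_recl big_ord0 !mxE !big_ord_recl !big_ord0 !mxE /=.
by rewrite /cos3 /bump /= !addn0 ?addn1 /=; ring.
Qed.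

Lemma valueE n (f : 'I_n -> seq R) t j :
  ((\matrix_(i < n, j < 5) (f i)`_j) *m value t) j ord0 = (f j)`_2.
Proof. by rewrite !mxE !big_ord_recl !big_ord0 !mxE /=; ring. Qed.

Lemma features_tokenE v : v != 0 ->
  features v = [:: fixed_round h.*2 (cos (v * (pi *+ 2 / M%:R)));
                   fixed_round h.*2 (sin (v * (pi *+ 2 / M%:R))); 1; 0].
Proof. by rewrite /features => /negPf ->. Qed.

Lemma features_blankE : features 0 = [:: 0; 0; 0; 1].
Proof. by rewrite /features eqxx. Qed.

Lemma attention_pair_mass N (x : 'I_N -> R) (v : 'I_(N + 1) -> R) i :
  (forall j, x j != 0) -> (forall j, v (lshift 1 j) = x j) ->
  (forall j, v (rshift N j) = 0) ->
  attention (s := 3) query key value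
    (\matrix_(i < N + 1, j < 5) (features (v i))`_j) (lshift 1 i) ord0 =
  pair_mass (fun j1 j2 =>
    c * cos3 (features (x i)) (features (x j1)) (features (x j2))) w.
Proof.
move=> x0 vl vr; rewrite attention3E.
pose F j1 j2 := c * cos3 (features (v (lshift 1 i))) (features (v j1))
    (features (v j2)) + w * ((features (v (lshift 1 i)))`_2 *
    (features (v j1))`_3 * (features (v j2))`_3).
pose S j1 j2 := c * cos3 (features (x i)) (features (x j1)) (features (x j2)).
have nonblank j : (features (v (lshift 1 j)))`_2 = 1.
  by rewrite vl features_tokenE.
have blank : (features (v (rshift N ord0)))`_2 = 0.
  by rewrite vr features_blankE.
have Fll j1 j2 : F (lshift 1 j1) (lshift 1 j2) = S j1 j2.
  rewrite /F /S !vl [X in _ + w * X](_ : _ = 0) ?mulr0 ?addr0//.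
  by rewrite !features_tokenE//= !mulr0.
have Flr j : F (lshift 1 j) (rshift N ord0) = 0.
  by rewrite /F !vl vr features_blankE !features_tokenE// /cos3 /=; ring.
have Frl j : F (rshift N ord0) (lshift 1 j) = 0.
  by rewrite /F !vl vr features_blankE !features_tokenE// /cos3 /=; ring.
have Frr : F (rshift N ord0) (rshift N ord0) = w.
  by rewrite /F !vl vr features_blankE !features_tokenE// /cos3 /=; ring.
rewrite /pair_mass; congr (_ / _).
  (* Numerator: a pair containing the blank has value product 0. *)
  under eq_bigr => j1 _ do under eq_bigr => j2 _ do
    rewrite scoreE !valueE -/(F j1 j2).
  rewrite big_split_ord big_ord1 /= [X in _ + X]big1 ?addr0; last first.
    by move=> j _; rewrite blank mul0r mulr0.
  apply: eq_bigr => j1 _.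
  rewrite big_split_ord big_ord1 /= blank !mulr0 addr0.
  by apply: eq_bigr => j2 _; rewrite !nonblank Fll !mulr1.
(* Denominator: the mixed pairs contribute 2 N times e^0, the pair of blanks e^w. *)
under eq_bigr => j1 _ do under eq_bigr => j2 _ do rewrite scoreE -/(F j1 j2).
rewrite big_split_ord big_ord1 /= big_split_ord big_ord1 /= Frr.
under eq_bigr => j1 _.
  rewrite big_split_ord big_ord1 /= Flr expR0.
  under eq_bigr => j2 _ do rewrite Fll.
  over.
under [X in _ + (X + _)]eq_bigr => j _ do rewrite Frl expR0.
by rewrite big_split /= !sumr_const card_ord /S -/(S _ _); ring.
Qed.

(** The 12 counts four products of three rounded factors, each factor off by at most 2^-h. *)
Lemma cos3_close a b d : (2 < h)%N -> a != 0 -> b != 0 -> d != 0 ->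
  `|cos3 (features a) (features b) (features d)
    - cos ((a + b + d) * (pi *+ 2 / M%:R))| <= 12 * 2 ^- h.
Proof.
move=> h2 a0 b0 d0; rewrite !features_tokenE// /cos3 /=.
set r := fixed_round _.
have cl := @fixed_round_close R h _ h2.
have nm := @fixed_round_norm_le1 R h _ (ltnW h2).
have close3 (p q t : R) : `|p| <= 1 -> `|q| <= 1 -> `|t| <= 1 ->
    `|r p * r q * r t - p * q * t| <= 3 * 2 ^- h.
  by move=> *; apply: mul3_close; rewrite ?cl ?nm.
set t := pi *+ 2 / _; rewrite !mulrDl cos3D.
move: (close3 _ _ _ (cos_max (a * t)) (cos_max (b * t)) (cos_max (d * t))).
move: (close3 _ _ _ (cos_max (a * t)) (sin_max (b * t)) (sin_max (d * t))).
move: (close3 _ _ _ (sin_max (a * t)) (sin_max (b * t)) (cos_max (d * t))).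
move: (close3 _ _ _ (sin_max (a * t)) (cos_max (b * t)) (sin_max (d * t))).
rewrite !ler_norml; lra.
Qed.

End Construction.

(** * Representable weights, the two MLPs, and their thresholds *)

Section Correctness.
Context {R : realType}.

Lemma query_fixed_point h (c w : R) : (0 < h)%N ->
  fixed_point h.*2 c -> fixed_point h.*2 (- c) -> fixed_point h.*2 w ->
  fixed_point_mx h.*2 (query c w).
Proof.
move=> h0 fc fNc fw i j.
have f0 : fixed_point h.*2 (0 : R).
  by apply: (fixed_point_int (k := 0)); rewrite ?normr0 ?exprn_gt0.
by rewrite mxE; case: i => [[|[|[|[|[|i]]]]] Hi] //;
  case: j => [[|[|[|[|[|j]]]]] Hj].
Qed.

Lemma zero_one_fixed_point h : (1 < h)%N ->
  fixed_point h.*2 (0 : R) /\ fixed_point h.*2 (1 : R).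
Proof.
move=> h1; split.
  by apply: (fixed_point_int (k := 0)); rewrite ?normr0 ?exprn_gt0//; lia.
apply: (fixed_point_int (k := 1)); first by lia.
by rewrite normr1 exprn_egt1//; lia.
Qed.

Lemma key_fixed_point h t : (1 < h)%N -> fixed_point_mx h.*2 (key t : 'M[R]_5).
Proof.
move=> /zero_one_fixed_point[f0 f1] i j; rewrite /key; case: ifP => _;
by rewrite mxE; case: i => [[|[|[|[|[|i]]]]] Hi] //;
  case: j => [[|[|[|[|[|j]]]]] Hj].
Qed.

Lemma value_fixed_point h t : (1 < h)%N ->
  fixed_point_mx h.*2 (value t : 'M[R]_5).
Proof.
move=> /zero_one_fixed_point[f0 f1] i j.
by rewrite mxE; case: i => [[|[|[|[|[|i]]]]] Hi] //;
  case: j => [[|[|[|[|[|j]]]]] Hj].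
Qed.

(** The inner rounding makes this, by idempotence, a function of the rounded input, as [mlp_class]
    demands; likewise for [output_mlp]. *)
Definition input_mlp h M (x : 'rV[R]_(1 + 1)) : 'rV[R]_5 :=
  \row_j (features h M (fixed_round h.*2 (x ord0 (lshift 1 ord0))))`_j.

Definition output_mlp h (y : 'rV[R]_5) : 'rV[R]_1 :=
  const_mx (2^-1 <= fixed_round h.*2 (y ord0 ord0))%R%:R.

Lemma input_mlpP h M : (1 < h)%N -> mlp_class (1 + 1) 5 h.*2 (input_mlp h M).
Proof.
move=> /zero_one_fixed_point[f0 f1]; split=> x.
  by apply/rowP => j; rewrite !mxE fixed_round_idem.
move=> i j; rewrite mxE /features; case: ifP => _;
  by case: j => [[|[|[|[|[|j]]]]] Hj] //; exact: fixed_round_in.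
Qed.

Lemma output_mlpP h : (1 < h)%N -> mlp_class 5 1 h.*2 (output_mlp h).
Proof.
move=> /zero_one_fixed_point[f0 f1]; split=> y.
  by rewrite /output_mlp !mxE fixed_round_idem.
by move=> i j; rewrite mxE; case: (_ <= _).
Qed.

(** Both 1/2 and 1/4 are exactly representable, so by monotonicity rounding cannot carry the
    attention output across the threshold. *)
Lemma output_mlpE h (y : 'rV[R]_5) (match3 : bool) : (2 < h)%N ->
  (match3 -> 2^-1 <= y ord0 ord0) -> (~~ match3 -> y ord0 ord0 <= 4^-1) ->
  output_mlp h y ord0 ord0 = match3%:R.
Proof.
move=> h2 ge_half le_quarter; rewrite mxE; congr (nat_of_bool _)%:R.
have inv_fixed k : (k < h)%N -> fixed_round h.*2 (2 ^- k : R) = 2 ^- k.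
  move=> kh; apply: fixed_round_id.
  have -> : 2 ^- k = (2 ^+ (h - k) : int)%:~R / 2 ^+ h :> R.
    rewrite rmorphXn /= -[in 2 ^+ h](subnK (ltnW kh)) exprD.
    by field; rewrite !expf_neq0 ?pnatr_eq0.
  apply: fixed_point_fraction; first by lia.
  by rewrite ger0_norm ?exprn_ge0// ltr_eXn2l//; lia.
case: match3 ge_half le_quarter => [/(_ isT) yge _|_ /(_ isT) yle].
  rewrite -[X in X^-1 <= _]expr1 -(inv_fixed 1%N) ?le_fixed_round ?expr1//.
  by lia.
have q : 4^-1 = 2 ^- 2 :> R by rewrite expr2 -natrM.
apply/negbTE; rewrite -ltNge (le_lt_trans (le_fixed_round _ yle))//.
rewrite q inv_fixed//; lra.
Qed.

Lemma cos3_match h M (a b d : nat) : (2 < h)%N -> (0 < M)%N ->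
  (0 < a)%N -> (0 < b)%N -> (0 < d)%N ->
  let T : R :=
    cos3 (features h M a%:R) (features h M b%:R) (features h M d%:R) in
  ((M %| a + b + d)%N -> 1 - 12 * 2 ^- h <= T) /\
  (~~ (M %| a + b + d)%N -> T <= 1 - 2 * (M%:R^-1) ^+ 2 + 12 * 2 ^- h).
Proof.
move=> h2 M0 a0 b0 d0 T.
have neq0 n : (0 < n)%N -> n%:R != 0 :> R by rewrite pnatr_eq0 -lt0n.
have := cos3_close M h2 (neq0 _ a0) (neq0 _ b0) (neq0 _ d0).
rewrite -/T -!natrD ler_norml => /andP[T1 T2]; split=> Md.
  by move: T1; rewrite cos_fraction_eq1//; lra.
by move: (@cos_fraction_le R _ _ M0 Md); lra.
Qed.

(** The bound on [M] makes every token representable, so the input rounding leaves it intact. *)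
Lemma input_rows h M N (X : 'I_N -> nat) : (1 < h)%N -> (M < 2 ^ h.-1)%N ->
  (forall i, (1 <= X i <= M)%N) ->
  rowwise (input_mlp h M) (with_position (with_blank X (0 : R))) =
  \matrix_(i < N + 1, j < 5)
    (features h M
      (match fintype.split i with inl i' => (X i')%:R | inr _ => 0 end))`_j.
Proof.
move=> h1 Mh Xb; apply/matrixP => i j; rewrite !mxE (unsplitK (inl ord0)).
have -> : with_blank X 0 i ord0 =
    match fintype.split i with inl i' => (X i')%:R | inr _ => 0 end :> R.
  by rewrite mxE; case: fintype.split => k; rewrite mxE.
rewrite fixed_round_id//; case: fintype.split => k; last first.
  by case: (zero_one_fixed_point h1).
apply: (fixed_point_int (k := X k)); first by lia.
by rewrite ger0_norm// -[X in X < _]natz -natrX ltr_nat; have := Xb k; lia.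
Qed.

End Correctness.

(** With l the bit length of M, 2^l <= 2 M <= (M + 1)^2 gives l ln 2 <= 2 ln (M + 1); the additive
    12 is absorbed through ln 2 <= ln (M + 1). *)
Lemma bit_length_bound {R : realType} (M b : nat) : (0 < M)%N ->
  ((b.+2 * (trunc_log 2 M).+1 + 6).*2)%:R <=
  (4 * b.+2%:R + 12) / ln 2 * ln M.+1%:R :> R.
Proof.
move=> M0; set l := (trunc_log 2 M).+1.
have ln2 : 0 < ln 2 :> R by rewrite ln_gt0// ltr1n.
have lM : ln 2 <= ln M.+1%:R :> R by rewrite ler_ln ?posrE// ler_nat.
have ll : l%:R * ln 2 <= 2 * ln M.+1%:R :> R.
  rewrite !mulr_natl -!lnXn// ler_ln ?posrE ?exprn_gt0// -!natrX ler_nat.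
  have := trunc_logP (isT : 1 < 2)%N M0; rewrite /l expnS; nia.
have b0 : 0 <= b.+2%:R :> R by [].
rewrite mulrAC ler_pdivlMr// -mul2n natrM natrD natrM -/l; nra.
Qed.

(* a is the exponent in M = N^O(1); N <= 2 ^ (M ^ b) keeps log N polynomial
   in M, without which p = O(log M) bits do not suffice; M + 1 instead of M
   under the logarithm only serves to include M = 1. *)
Theorem theorem18 (R : realType) (a b : nat) :
  exists C : R, forall N M : nat,
    (1 <= M)%N -> (M <= N ^ a)%N -> (N <= 2 ^ (M ^ b))%N ->
    exists p : nat, p%:R <= C * ln (M.+1)%:R /\
      exists (x' : R) (f : 'M[R]_(N + 1, 1 + 1) -> 'M[R]_(N + 1, 1)),
        transformer_class (N + 1) 3 (1 + 1) 5 1 p f /\ represents M x' f (@Match3 M N).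
Proof.
exists ((4 * b.+2%:R + 12) / ln 2) => N M M0 _ Nb.
(* This [h] gives the scale c = 2^(h - 2) = 2 u 4^l for the margin u = 2^(b l + 3) below. As M <
   2^l, the cosine gap 2 c / M^2 is then at least 4 u. *)
set l := (trunc_log 2 M).+1; pose h := (b.+2 * l + 6)%N.
exists h.*2; split; first exact: bit_length_bound.
have Ml : (M < 2 ^ l)%N by exact: trunc_log_ltn.
(* c is the scale of the cosine; w lies 2 u below c and 2 u above the largest
   mismatch score c (1 - 2 / M ^ 2) <= c - 4 u, and the rounding of the features
   moves each score by at most 3 <= u. *)
pose c : int := 2 ^+ h.-2; pose u : int := 2 ^+ (b * l + 3).
pose w : int := c - 2 * u.
have h2 : (2 < h)%N by rewrite /h; lia.
have cE : c = u * (2 * (2 ^+ l) ^+ 2).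
  rewrite -exprM -exprS -exprD; congr (_ ^+ _); rewrite /h; lia.
have u0 : 0 < u by rewrite exprn_gt0.
have l1 : 1 <= 2 ^+ l :> int by rewrite exprn_ege1.
have w_ge0 : 0 <= w by rewrite /w cE; nia.
have hc : c < 2 ^+ h.-1 by rewrite ltr_eXn2l//; lia.
have c_int : `|c| < 2 ^+ h.-1 by lia.
have Nc_int : `|- c| < 2 ^+ h.-1 by lia.
have w_int : `|w| < 2 ^+ h.-1 by lia.
have h1 : (1 < h)%N by lia.
have h0 : (0 < h)%N by lia.
pose f X := rowwise (output_mlp h)
  (attention (s := 3) (query c%:~R w%:~R) key value
    (rowwise (input_mlp h M) X)) : 'M[R]_(N + 1, 1).
exists 0, f; split.
  exists (input_mlp h M), (attention (s := 3) (query c%:~R w%:~R) key value),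
    (output_mlp h); split=> //; [exact: input_mlpP| |exact: output_mlpP].
  exists (query c%:~R w%:~R), key, value; split=> //.
  - apply: query_fixed_point => //; rewrite -?rmorphN; exact: fixed_point_int.
  - by move=> t; exact: key_fixed_point.
  - by move=> t; exact: value_fixed_point.
move=> X Xb; apply/matrixP => i j; rewrite ord1 {j}.
have Mh : (M < 2 ^ h.-1)%N.
  by rewrite (leq_trans Ml)// leq_exp2l// /h; lia.
pose v (k : 'I_(N + 1)) : R :=
  match fintype.split k with inl i' => (X i')%:R | inr _ => 0 end.
have X0 k : (X k)%:R != 0 :> R by rewrite pnatr_eq0 -lt0n; have /andP[] := Xb k.
have vl k : v (lshift 1 k) = (X k)%:R.
  by rewrite /v -/(unsplit (inl k)) unsplitK.
have vr k : v (rshift N k) = 0 by rewrite /v -/(unsplit (inr k)) unsplitK.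
have massE := attention_pair_mass h M c%:~R w%:~R i X0 vl vr.
have Dlarge : 8 * N.+1%:R ^+ 2 <= expR (u%:~R : R).
  have := softmax_margin M0 (ltnW Ml) Nb; rewrite -(ler_nat R) natrM !natrX.
  have -> : u%:~R = (2 ^ (b * l + 3))%:R :> R by rewrite rmorphXn natrX.
  by move=> /le_trans; apply; exact: expR_nat_ge.
have c0 : 0 < c%:~R :> R by rewrite ltr0z exprn_gt0.
have u3 : 3 <= u%:~R :> R.
  rewrite (ler_int R 3) /u exprD.
  have : (1 : int) <= 2 ^+ (b * l) by rewrite exprn_ege1.
  by rewrite !exprS expr0; lia.
have rounding : c%:~R * (12 * 2 ^- h) = 3 :> R.
  rewrite rmorphXn /= -[in 2 ^- h](subnK h1) exprD.
  have -> : (h - 2 = h.-2)%N by lia.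
  by field; rewrite expf_neq0 ?pnatr_eq0.
have gap : 4 * u%:~R <= c%:~R * (2 * M%:R^-1 ^+ 2) :> R.
  have M0r : 0 < M%:R :> R by rewrite ltr0n.
  have -> : c%:~R = u%:~R * (2 * (2 ^+ l) ^+ 2) :> R.
    by rewrite cE; move: (u) => u'; rewrite !rmorphM /= !rmorphXn.
  rewrite exprVn [leRHS]mulrA ler_pdivlMr ?exprn_gt0//.
  have Mlr : M%:R <= 2 ^+ l :> R by rewrite -natrX ler_nat ltnW.
  have : M%:R ^+ 2 <= (2 ^+ l) ^+ 2 :> R by rewrite lerXn2r ?nnegrE ?exprn_ge0.
  nra.
have wE : w%:~R = c%:~R - 2 * u%:~R :> R by rewrite rmorphB rmorphM.
have scores j1 j2 := @cos3_match R _ _ _ _ _ h2 M0 (proj1 (andP (Xb i)))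
  (proj1 (andP (Xb j1))) (proj1 (andP (Xb j2))).
rewrite /f input_rows// [LHS]mxE [LHS]mxE [RHS]mxE -/v.
apply: output_mlpE => // [/existsP[j1 /existsP[j2]]|nomatch]; rewrite mxE massE.
  rewrite mod0n => dvdM.
  apply: (@pair_mass_ge _ _ _ _ _ j1 j2 Dlarge); first by rewrite ler0z.
  (* A match scores at least c - 3 >= c - u = w + u. *)
  have := (scores j1 j2).1 dvdM; rewrite -(ler_pM2l c0) wE; lra.
apply: (pair_mass_le Dlarge) => j1 j2.
have ndvdM : ~~ (M %| X i + X j1 + X j2)%N.
  apply: contra nomatch => dvdM.
  by apply/existsP; exists j1; apply/existsP; exists j2; rewrite mod0n.
(* A mismatch scores at most c - 4 u + 3 <= c - 3 u = w - u. *)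
have := (scores j1 j2).2 ndvdM; rewrite -(ler_pM2l c0) wE; lra.
Qed.
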